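(* Let $Q$ be a midpoint diagonal quadrilateral. (i) There is a unique ellipse $E_I$ of minimal eccentricity among all ellipses inscribed in $Q$. (ii) Furthermore, the unique pair of conjugate diameters of $E_I$ parallel to the diagonals of $Q$ (one diameter parallel to each diagonal) are equal conjugate diameters of $E_I$, i.e. the two diameters have the same length.
   Context: An ellipse (circles included, with eccentricity $0$) is inscribed in a convex quadrilateral $Q$ if it lies inside $Q$ and is tangent to each side of $Q$. A convex quadrilateral $Q$ is a midpoint diagonal quadrilateral if the intersection point of its diagonals coincides with the midpoint of at least one of the diagonals. The eccentricity of an ellipse with semi-major axis length $a$ and semi-minor axis length $b$ is $\sqrt{1-b^2/a^2}$. A diameter of an ellipse is a chord through its center. Given a diameter $l$ of an ellipse $E_0$, there is a unique diameter $m$ of $E_0$ such that the midpoints of all chords of $E_0$ parallel to $l$ lie on $m$; then $l$ and $m$ are called conjugate diameters of $E_0$. They are equal conjugate diameters if moreover $|l|=|m|$. Two lines are called parallel also when they are equal; segments are parallel if the lines containing them are. It is a fact that every ellipse inscribed in a midpoint diagonal quadrilateral $Q$ has a unique pair of conjugate diameters parallel to the diagonals of $Q$; this is the pair referred to in (ii). *)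

(* Defs.v *)
From mathcomp Require Import all_boot all_order all_algebra.
From mathcomp Require Import classical_sets reals.

Set Implicit Arguments.
Unset Strict Implicit.
Unset Printing Implicit Defensive.

Import Order.TTheory GRing.Theory Num.Theory.
Local Open Scope classical_set_scope.
Local Open Scope ring_scope.

Section PlaneGeometry.
Variable R : realType.
Notation point := 'rV[R]_2.
Implicit Types p q u v : point.

Definition dot u v : R := \sum_i u 0 i * v 0 i.

Definition cross u v : R := u 0 0 * v 0 1 - u 0 1 * v 0 0.

Definition rot90 u : point := \row_i (if i == 0 then - u 0 1 else u 0 0).

Definition midpoint p q : point := 2^-1 *: (p + q).

Definition dist p q : R := Num.sqrt (dot (q - p) (q - p)).

Definition line p q : set point :=
  [set x | exists t : R, x = (1 - t) *: p + t *: q].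

Definition segment p q : set point :=
  [set x | exists t : R, 0 <= t <= 1 /\ x = (1 - t) *: p + t *: q].

(* A pair of points s stands for the segment with endpoints s.1 and s.2; as
   diameters, (p, q) and (q, p) are identified through their segments. Lines
   that coincide are parallel. *)
Definition parallel (s t : point * point) : Prop :=
  cross (s.2 - s.1) (t.2 - t.1) = 0.

(* A quadrilateral is given by its vertices in cyclic order; indices are
   computed in the ring 'I_4 of integers modulo 4. *)
Definition quadrilateral := 'I_4 -> point.
Implicit Types Q : quadrilateral.

(* Each side lies on a line having the other two vertices strictly on the same
   side; this excludes degenerate, nonconvex and self-crossing polygons. *)
Definition convex_quadrilateral Q : Prop :=
  forall i : 'I_4,
    0 < cross (Q (i + 1) - Q i) (Q (i + 2) - Q i) *
        cross (Q (i + 1) - Q i) (Q (i + 3) - Q i).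

Definition quad_region Q : set point :=
  [set x | exists w : 'I_4 -> R,
     [/\ forall i, 0 <= w i, \sum_i w i = 1 & x = \sum_i w i *: Q i]].

Definition diagonal02 Q : point * point := (Q 0, Q 2).
Definition diagonal13 Q : point * point := (Q 1, Q 3).

Definition midpoint_diagonal_quadrilateral Q : Prop :=
  convex_quadrilateral Q /\
  exists P : point,
    segment (Q 0) (Q 2) `&` segment (Q 1) (Q 3) = [set P] /\
    (P = midpoint (Q 0) (Q 2) \/ P = midpoint (Q 1) (Q 3)).

(* The same ellipse has several descriptions (at least major_dir can be
   negated), so equality of ellipses is equality of their curves. *)
Record ellipse := Ellipse {
  center : point;
  major_dir : point;
  semi_major : R;
  semi_minor : R;
  major_dir_unit : dot major_dir major_dir = 1;
  semi_minor_gt0 : 0 < semi_minor;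
  semi_minor_le_major : semi_minor <= semi_major
}.
Implicit Types E : ellipse.

Definition curve E : set point :=
  [set x | (dot (x - center E) (major_dir E) / semi_major E) ^+ 2 +
           (dot (x - center E) (rot90 (major_dir E)) / semi_minor E) ^+ 2 = 1].

Definition eccentricity E : R :=
  Num.sqrt (1 - semi_minor E ^+ 2 / semi_major E ^+ 2).

(* A line is tangent to an ellipse when they have exactly one common point;
   here that point must moreover lie on the segment. *)
Definition tangent_to_segment E p q : Prop :=
  exists T : point, segment p q T /\ curve E `&` line p q = [set T].

Definition inscribed E Q : Prop :=
  curve E `<=` quad_region Q /\
  forall i : 'I_4, tangent_to_segment E (Q i) (Q (i + 1)).

Definition minimal_eccentricity_inscribed E Q : Prop :=
  inscribed E Q /\
  forall E', inscribed E' Q -> eccentricity E <= eccentricity E'.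

Definition chord E (s : point * point) : Prop :=
  [/\ curve E s.1, curve E s.2 & s.1 <> s.2].

Definition diameter E (s : point * point) : Prop :=
  chord E s /\ segment s.1 s.2 (center E).

Definition conjugate_diameters E (l m : point * point) : Prop :=
  [/\ diameter E l, diameter E m &
      forall s, chord E s -> parallel s l ->
        segment m.1 m.2 (midpoint s.1 s.2)].

Definition equal_conjugate_diameters E (l m : point * point) : Prop :=
  conjugate_diameters E l m /\ dist l.1 l.2 = dist m.1 m.2.

Definition conjugate_diameters_along_diagonals E Q (l m : point * point) :=
  [/\ conjugate_diameters E l m,
      parallel l (diagonal02 Q) & parallel m (diagonal13 Q)].

End PlaneGeometry.

(* Main.v *)
(* Let [P] be the intersection of the diagonals and, say, the midpoint of the
   first one, so that the vertices are [P - u], [P + v], [P + u], [P - k v] with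
   [k > 0]. In the coordinates given by [u] and [v], tangency to the four sides
   forces an inscribed ellipse to be centered at some [P + y v] and to have
   [A u] and [B v] as conjugate radii, where
     [A^2 + B^2 = (1 - y)^2]  and  [k^2 A^2 + B^2 = (k + y)^2];
   conversely every solution with [-k < y < 1] gives an inscribed ellipse. If
   [a >= b] are the semi-axes, then [a^2 + b^2 = |A u|^2 + |B v|^2] and
   [a b = |cross (A u) (B v)|] by Apollonius, so [a/b + b/a] is proportional to
   [A |u| / (B |v|) + B |v| / (A |u|)], which is minimal exactly when
   [A |u| = B |v|]. The ratio [A / B] determines [y], [A] and [B]. *)

Require Import Defs.
From mathcomp Require Import all_boot all_order all_algebra.
From mathcomp Require Import classical_sets reals.
From mathcomp Require Import ring lra.

Set Implicit Arguments.
Unset Strict Implicit.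
Unset Printing Implicit Defensive.

Import Order.TTheory GRing.Theory Num.Theory.
Local Open Scope classical_set_scope.
Local Open Scope ring_scope.

Section Proof.
Variable R : realType.
Notation point := 'rV[R]_2.
Implicit Types (E : ellipse R) (Q : quadrilateral R).
Implicit Types P c p q u v w x y f g : point.

(** * Coordinates in the plane and indices modulo 4 *)

Lemma dot_coord u v : dot u v = u 0 0 * v 0 0 + u 0 1 * v 0 1.
Proof.
by rewrite /dot !big_ord_recl big_ord0 addr0; do 2 f_equal; f_equal; exact: val_inj.
Qed.

Lemma point_eqP x y : x 0 0 = y 0 0 -> x 0 1 = y 0 1 -> x = y.
Proof.
move=> e0 e1; apply/rowP => i; case: i => [[|[|//]] lt_i].
  by rewrite (_ : Ordinal lt_i = 0) //; exact: val_inj.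
by rewrite (_ : Ordinal lt_i = 1) //; exact: val_inj.
Qed.

Lemma rot90_coord u : (rot90 u 0 0 = - u 0 1) * (rot90 u 0 1 = u 0 0).
Proof. by rewrite /rot90 !mxE. Qed.

Lemma sum4 (V : zmodType) (F : 'I_4 -> V) :
  \sum_i F i = F 0 + F 1 + F 2 + F 3.
Proof.
rewrite !big_ord_recl big_ord0 addr0 !addrA.
by do ![congr (_ + _)]; congr F; exact: val_inj.
Qed.

Lemma ord4_ind (P : 'I_4 -> Prop) : P 0 -> P 1 -> P 2 -> P 3 -> forall i, P i.
Proof.
move=> P0 P1 P2 P3 [[|[|[|[|//]]]] lt_i].
- by rewrite (_ : Ordinal lt_i = 0) //; exact: val_inj.
- by rewrite (_ : Ordinal lt_i = 1) //; exact: val_inj.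
- by rewrite (_ : Ordinal lt_i = 2) //; exact: val_inj.
- by rewrite (_ : Ordinal lt_i = 3) //; exact: val_inj.
Qed.

(** * The quadratic form of an ellipse *)

(** The bilinear form of the ellipse multiplied by [a^2 b^2], which avoids divisions.
    [cross x (major_dir E)] is, up to a sign that cancels, the coordinate of [x] along the minor
    axis. *)
Definition polar E x y : R :=
  semi_minor E ^+ 2 * (dot x (major_dir E) * dot y (major_dir E)) +
  semi_major E ^+ 2 * (cross x (major_dir E) * cross y (major_dir E)).

Definition form E x : R := polar E x x.

Definition area2 E : R := (semi_major E * semi_minor E) ^+ 2.

Ltac coords := rewrite /form /polar /cross /midpoint ?dot_coord ?rot90_coord ?mxE.

Lemma semi_major_gt0 E : 0 < semi_major E.
Proof. exact: lt_le_trans (semi_minor_gt0 E) (semi_minor_le_major E). Qed.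

Lemma area2_gt0 E : 0 < area2 E.
Proof. by rewrite exprn_gt0 // mulr_gt0 ?semi_major_gt0 ?semi_minor_gt0. Qed.

Lemma curveE E x : curve E x <-> form E (x - center E) = area2 E.
Proof.
have a0 := lt0r_neq0 (semi_major_gt0 E); have b0 := lt0r_neq0 (semi_minor_gt0 E).
rewrite /curve /=.
have -> : (dot (x - center E) (major_dir E) / semi_major E) ^+ 2 +
  (dot (x - center E) (rot90 (major_dir E)) / semi_minor E) ^+ 2 =
  form E (x - center E) / area2 E.
  by rewrite /area2; coords; field; rewrite a0 b0.
split=> [/(divr1_eq)//|->]; exact: divff (lt0r_neq0 (area2_gt0 E)).
Qed.

Lemma form_lin E (s t : R) f g :
  form E (s *: f + t *: g) =
  s ^+ 2 * form E f + 2 * s * t * polar E f g + t ^+ 2 * form E g.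
Proof. by coords; ring. Qed.

Lemma major_dir_coord E : major_dir E 0 0 ^+ 2 + major_dir E 0 1 ^+ 2 = 1.
Proof. by have := major_dir_unit E; rewrite dot_coord -!expr2. Qed.

(** In the orthonormal basis of the axes the form has matrix [diag(b^2, a^2)], of determinant
    [area2 E]; a Gram determinant scales by [cross u v ^+ 2]. The identity becomes polynomial once 1
    is replaced by the fourth power of the norm of [major_dir E]. *)
Lemma form_gram E u v :
  form E u * form E v - polar E u v ^+ 2 = area2 E * cross u v ^+ 2.
Proof.
rewrite -[RHS]mulr1 -[X in _ = _ * X](expr1n _ 2) -[in RHS](major_dir_coord E) /area2.
by coords; ring.
Qed.

(** The trace of the form written in an arbitrary pair of vectors: for orthonormal [u], [v] the left
    side is [form E u + form E v]. *)
Lemma form_trace E u v :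
  dot v v * form E u - 2 * dot u v * polar E u v + dot u u * form E v =
  (semi_major E ^+ 2 + semi_minor E ^+ 2) * cross u v ^+ 2.
Proof.
rewrite -[RHS]mulr1 -[in RHS](major_dir_coord E).
by coords; ring.
Qed.

Lemma dot_gt0 u : u != 0 -> 0 < dot u u.
Proof.
move=> u0; rewrite dot_coord -!expr2 lt0r.
rewrite addr_ge0 ?sqr_ge0 // andbT paddr_eq0 ?sqr_ge0 // !sqrf_eq0.
by apply: contra u0 => /andP[/eqP e0 /eqP e1]; apply/eqP/point_eqP; rewrite mxE.
Qed.

Lemma form_gt0 E u : u != 0 -> 0 < form E u.
Proof.
move=> u0.
have [b0 a0] := (semi_minor_gt0 E, semi_major_gt0 E).
have lb : semi_minor E ^+ 2 * dot u u <= form E u.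
  rewrite -[leLHS]mulr1 -(major_dir_coord E) -subr_ge0.
  have -> : form E u - semi_minor E ^+ 2 * dot u u *
     (major_dir E 0 0 ^+ 2 + major_dir E 0 1 ^+ 2) =
     (semi_major E ^+ 2 - semi_minor E ^+ 2) * cross u (major_dir E) ^+ 2.
    by coords; ring.
  by rewrite mulr_ge0 ?sqr_ge0 // subr_ge0 lerXn2r ?nnegrE ?semi_minor_le_major ?ltW.
apply: lt_le_trans lb; by rewrite mulr_gt0 ?exprn_gt0 ?dot_gt0.
Qed.

Lemma form_line E p w (t : R) :
  form E (p + t *: w - center E) =
  form E w * t ^+ 2 + 2 * t * polar E (p - center E) w + form E (p - center E).
Proof. by coords; ring. Qed.

Lemma lineE p q x : line p q x <-> exists t : R, x = p + t *: (q - p).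
Proof.
by split=> -[t ->]; exists t; apply: point_eqP; coords; ring.
Qed.

(* A quadratic polynomial has exactly one root iff its discriminant vanishes;
   the root then is [- polar E (p - center E) (q - p) / form E (q - p)]. *)
Lemma tangent_lineP E p q : p != q ->
  (exists T, curve E `&` line p q = [set T]) <->
  form E (q - p) = cross (q - p) (center E - p) ^+ 2.
Proof.
move=> npq; set w := q - p; set c := center E.
have w0 : w != 0 by rewrite subr_eq0 eq_sym.
have A0 := form_gt0 E w0; have D0 := area2_gt0 E.
have A_neq0 := lt0r_neq0 A0.
set A := form E w; set B := polar E (p - c) w.
set C := form E (p - c) - area2 E.
have onC t : curve E (p + t *: w) <-> A * t ^+ 2 + 2 * t * B + C = 0.
  rewrite curveE form_line -/c -/A -/B /C; split=> [<-|/eqP]; first by ring.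
  by rewrite addrA subr_eq0 => /eqP.
(* The Gram identity turns the discriminant into a positive multiple of the defect in the tangency
   equation. *)
have disc : B ^+ 2 - A * C = area2 E * (A - cross w (c - p) ^+ 2).
  have := form_gram E (p - c) w; rewrite -/B -/A => gr.
  have -> : cross w (c - p) ^+ 2 = cross (p - c) w ^+ 2 by coords; ring.
  by rewrite [RHS]mulrBr -gr /C; ring.
split=> [[T Te]|tg].
- have [/= Tc /lineE [t Tt]] : (curve E `&` line p q) T by rewrite Te.
  rewrite Tt in Tc; move/onC: Tc => rt.
  (* By Vieta this is the other root; uniqueness of the common point makes it equal to [t], so the
     discriminant vanishes. *)
  have t'E : curve E (p + (- (2 * B) / A - t) *: w).
    by apply/onC; rewrite -[RHS]rt; field.
  have /= : [set T] (p + (- (2 * B) / A - t) *: w).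
    by rewrite -Te; split=> //; apply/lineE; exists (- (2 * B) / A - t).
  rewrite Tt => /addrI /eqP; rewrite -subr_eq0 -scalerBl scaler_eq0 (negPf w0) orbF.
  move=> /eqP e.
  have Bt : B = - (A * t).
    have -> : B = - (A * t) - A / 2 * (- (2 * B) / A - t - t) by field.
    by rewrite e; ring.
  have : B ^+ 2 - A * C = 0.
    have -> : B ^+ 2 - A * C = - A * (A * t ^+ 2 + 2 * t * B + C).
      by rewrite Bt; ring.
    by rewrite rt mulr0.
  rewrite disc => /eqP; rewrite mulf_eq0 (negPf (lt0r_neq0 D0)) /= subr_eq0.
  by move/eqP.
- rewrite -/A -/w in tg.
  have BC : B ^+ 2 - A * C = 0 by rewrite disc tg; ring.
  exists (p + (- B / A) *: w); apply/seteqP; split=> x /=.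
    case=> xc /lineE[t xt]; rewrite xt in xc *; congr (_ + _ *: _).
    move/onC: xc => rt.
    have : (A * t + B) ^+ 2 = 0.
      have -> : (A * t + B) ^+ 2 =
        B ^+ 2 - A * C + A * (A * t ^+ 2 + 2 * t * B + C) by ring.
      by rewrite BC rt mulr0 addr0.
    move=> /eqP; rewrite sqrf_eq0 => /eqP e.
    have -> : t = (A * t + B - B) / A by field.
    by rewrite e sub0r.
  move=> ->; split; last by apply/lineE; exists (- B / A).
  apply/onC.
  have -> : A * (- B / A) ^+ 2 + 2 * (- B / A) * B + C = - (B ^+ 2 - A * C) / A.
    by field.
  by rewrite BC oppr0 mul0r.
Qed.


(** * Conjugate radii *)

(** Cramer's rule. *)
Lemma cross_decomp f g x : cross f g != 0 ->
  x = (cross x g / cross f g) *: f + (cross f x / cross f g) *: g.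
Proof.
rewrite /cross => fg0.
by apply: point_eqP; rewrite !mxE; field.
Qed.

(** Conjugacy is orthogonality for [polar]. Such radii parametrize the curve by the unit circle, as
    [curve_radii] shows, so the axes are no longer needed. *)
Definition conjugate_radii E f g : Prop :=
  [/\ form E f = area2 E, form E g = area2 E & polar E f g = 0].

Lemma conjugate_radii_sym E f g :
  conjugate_radii E f g -> conjugate_radii E g f.
Proof. by case=> ef eg efg; split=> //; rewrite -efg; coords; ring. Qed.

Lemma conjugate_radii_oppr E f g :
  conjugate_radii E f (- g) -> conjugate_radii E f g.
Proof.
case=> ef eg efg; split=> //; first by rewrite -eg; coords; ring.
by rewrite -[RHS]oppr0 -efg; coords; ring.
Qed.

(** Apollonius: the parallelogram on two conjugate radii has area [a b]. This is the Gram identity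
    with diagonal entries [area2 E]. *)
Lemma conjugate_radii_cross E f g :
  conjugate_radii E f g -> cross f g ^+ 2 = area2 E.
Proof.
case=> ef eg efg; apply: (mulfI (lt0r_neq0 (area2_gt0 E))).
by rewrite -form_gram ef eg efg expr0n subr0.
Qed.

Lemma conjugate_radii_cross_neq0 E f g :
  conjugate_radii E f g -> cross f g != 0.
Proof.
by move/conjugate_radii_cross=> e; rewrite -sqrf_eq0 e lt0r_neq0 ?area2_gt0.
Qed.

(** The other theorem of Apollonius, read off from the trace identity. *)
Lemma conjugate_radii_dot E f g : conjugate_radii E f g ->
  dot f f + dot g g = semi_major E ^+ 2 + semi_minor E ^+ 2.
Proof.
move=> cfg; apply: (mulIf (lt0r_neq0 (area2_gt0 E))).
rewrite -[in RHS](conjugate_radii_cross cfg) -form_trace.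
by case: cfg => -> -> ->; ring.
Qed.

Lemma conjugate_radii_form E f g (s t : R) : conjugate_radii E f g ->
  form E (s *: f + t *: g) = area2 E * (s ^+ 2 + t ^+ 2).
Proof. by case=> ef eg efg; rewrite form_lin ef eg efg; ring. Qed.

Lemma curve_radii E f g (s t : R) : conjugate_radii E f g ->
  curve E (center E + (s *: f + t *: g)) <-> s ^+ 2 + t ^+ 2 = 1.
Proof.
move=> cfg; rewrite curveE addrC addKr (conjugate_radii_form _ _ cfg).
split=> [e|->]; last by rewrite mulr1.
by apply: (mulfI (lt0r_neq0 (area2_gt0 E))); rewrite mulr1.
Qed.

Lemma curve_radiiP E f g x : conjugate_radii E f g ->
  exists s t : R, x = center E + (s *: f + t *: g) /\
    (curve E x <-> s ^+ 2 + t ^+ 2 = 1).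
Proof.
move=> cfg; have xE := cross_decomp (x - center E) (conjugate_radii_cross_neq0 cfg).
move: (_ / _) (_ / _) xE => t s xE; exists s, t.
have -> : x = center E + (s *: f + t *: g) by rewrite -xE addrC subrK.
by split=> //; exact: curve_radii.
Qed.

Lemma eq_curve E E' f g : center E = center E' ->
  conjugate_radii E f g -> conjugate_radii E' f g -> curve E = curve E'.
Proof.
move=> ecc r r'; apply/seteqP.
by split=> x; have [s [t [-> ->]]] := curve_radiiP x r;
  have := curve_radii s t r'; rewrite ecc => -[].
Qed.

(** * Comparison of eccentricities *)

(** With [r = b^2 / a^2], the eccentricity is [sqrt (1 - r)] and
    [(a^2 + b^2)^2 / (a b)^2 = (1 + r)^2 / r]; both decrease in [r] on [(0, 1]]. The second
    comparison is cross-multiplied. *)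
Lemma eccentricity_le E E' :
  eccentricity E <= eccentricity E' <->
  (semi_major E ^+ 2 + semi_minor E ^+ 2) ^+ 2 * area2 E' <=
  (semi_major E' ^+ 2 + semi_minor E' ^+ 2) ^+ 2 * area2 E.
Proof.
have ratio (F : ellipse R) : exists r : R, [/\ 0 < r <= 1,
    eccentricity F = Num.sqrt (1 - r) &
    semi_minor F ^+ 2 = r * semi_major F ^+ 2].
  have a0 := semi_major_gt0 F; have b0 := semi_minor_gt0 F.
  exists (semi_minor F ^+ 2 / semi_major F ^+ 2); split=> //.
    rewrite divr_gt0 ?exprn_gt0 //= ler_pdivrMr ?exprn_gt0 // mul1r.
    by rewrite lerXn2r ?nnegrE ?semi_minor_le_major ?ltW.
  by rewrite divfK // expf_neq0 // lt0r_neq0.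
have [r [/andP[r0 r1] -> bE]] := ratio E.
have [s [/andP[s0 s1] -> bE']] := ratio E'.
rewrite /area2 !exprMn bE bE' ler_sqrt ?subr_ge0 //.
have := semi_major_gt0 E; have := semi_major_gt0 E'.
move: (semi_major E) (semi_major E') => a a' a'0 a0.
rewrite lerD2l lerN2.
have -> : (a ^+ 2 + r * a ^+ 2) ^+ 2 * (a' ^+ 2 * (s * a' ^+ 2)) =
  (a * a') ^+ 4 * ((1 + r) ^+ 2 * s) by ring.
have -> : (a' ^+ 2 + s * a' ^+ 2) ^+ 2 * (a ^+ 2 * (r * a ^+ 2)) =
  (a * a') ^+ 4 * ((1 + s) ^+ 2 * r) by ring.
rewrite ler_pM2l; last by rewrite exprn_gt0 // mulr_gt0.
rewrite -[X in is_true X <-> _]subr_ge0 -[X in _ <-> is_true X]subr_ge0.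
have -> : (1 + s) ^+ 2 * r - (1 + r) ^+ 2 * s = (r - s) * (1 - r * s) by ring.
have rs1 : r * s <= 1 by rewrite mulr_ile1 // ltW.
split=> [rs|]; first by rewrite mulr_ge0 // subr_ge0.
(* The factor [1 - r * s] can be cancelled unless it is 0; in that case [r = 1], that is, [E] is a
   circle. *)
have [rs_eq1|rs_neq1] := eqVneq (r * s) 1.
  have -> : r = 1 by apply/eqP; rewrite eq_le r1 -rs_eq1 ger_pMr.
  by rewrite subr_ge0.
by rewrite pmulr_lge0 // subr_gt0 lt_neqAle rs_neq1.
Qed.

Lemma eccentricity_le_radii E E' f g f' g' :
  conjugate_radii E f g -> conjugate_radii E' f' g' ->
  eccentricity E <= eccentricity E' <->
  (dot f f + dot g g) ^+ 2 * cross f' g' ^+ 2 <=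
  (dot f' f' + dot g' g') ^+ 2 * cross f g ^+ 2.
Proof.
move=> r r'; rewrite eccentricity_le.
by rewrite !(conjugate_radii_dot r, conjugate_radii_dot r',
             conjugate_radii_cross r, conjugate_radii_cross r').
Qed.

(** * Construction of an ellipse from equal conjugate radii *)

Lemma cross_neq0 u v : cross u v != 0 -> u != 0 /\ v != 0.
Proof.
by move=> h; split; apply: contraNneq h => ->; apply/eqP; coords; ring.
Qed.

(* Equal conjugate radii are symmetric about the axes, so the axes lie along
   their sum and their difference. *)
Lemma ellipse_of_equal_radii c f g : dot f f = dot g g -> cross f g != 0 ->
  exists E, center E = c /\ conjugate_radii E f g.
Proof.
(* Changing the sign of [g] exchanges [f + g] and [f - g]; the normalization makes the sum the
   longer one, hence the major axis. *)
wlog fg0 : g / 0 <= dot f g.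
  move=> IH efg cfg; have [|/ltW fg_le0] := lerP 0 (dot f g).
    by move=> ?; exact: IH.
  have [|||E [cE rE]] := IH (- g).
  - by rewrite (_ : dot f (- g) = - dot f g) ?oppr_ge0 //; coords; ring.
  - by rewrite efg; coords; ring.
  - by rewrite (_ : cross f (- g) = - cross f g) ?oppr_eq0 //; coords; ring.
  by exists E; split=> //; exact: conjugate_radii_oppr.
move=> efg cfg; set s := f + g; set r := f - g.
have sr : cross s r = - 2 * cross f g by rewrite /s /r; coords; ring.
have [s0 r0] : s != 0 /\ r != 0.
  by apply: cross_neq0; rewrite sr mulf_neq0 // oppr_eq0 pnatr_eq0.
have S0 := dot_gt0 s0; have D0 := dot_gt0 r0.
have SE : dot s s = dot f f + dot g g + 2 * dot f g by rewrite /s; coords; ring.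
have DE : dot r r = dot f f + dot g g - 2 * dot f g by rewrite /r; coords; ring.
(* The parallelogram on [f], [g] is a rhombus, so its diagonals [s] and [r] are orthogonal. *)
have SD : dot s s * dot r r = 4 * cross f g ^+ 2.
  rewrite SE DE -efg.
  have -> : cross f g ^+ 2 = dot f f * dot g g - dot f g ^+ 2 by coords; ring.
  by rewrite -efg; ring.
have rs2 : 0 < Num.sqrt 2 :> R by rewrite sqrtr_gt0.
set n := Num.sqrt (dot s s); set m := Num.sqrt (dot r r).
have n0 : 0 < n by rewrite sqrtr_gt0.
have m0 : 0 < m by rewrite sqrtr_gt0.
have n2 : n ^+ 2 = dot s s by rewrite sqr_sqrtr // ltW.
have m2 : m ^+ 2 = dot r r by rewrite sqr_sqrtr // ltW.
have d_unit : dot (n^-1 *: s) (n^-1 *: s) = 1.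
  have -> : dot (n^-1 *: s) (n^-1 *: s) = dot s s / n ^+ 2.
    by coords; field; exact: lt0r_neq0.
  by rewrite n2 divff // lt0r_neq0.
(* Equal conjugate radii are [(a e + b e') / sqrt 2] and [(a e - b e') / sqrt 2] for unit axis
   vectors [e], [e']; hence [|s| = sqrt 2 a] and [|r| = sqrt 2 b]. *)
have b_gt0 : 0 < m / Num.sqrt 2 by rewrite divr_gt0.
have b_le_a : m / Num.sqrt 2 <= n / Num.sqrt 2.
  apply: ler_wpM2r; first by rewrite invr_ge0 ltW.
  by rewrite ler_sqrt ?(ltW S0) // SE DE; lra.
exists (Ellipse c d_unit b_gt0 b_le_a); split=> //.
set E := Ellipse _ _ _ _.
have a2 : semi_major E ^+ 2 = dot s s / 2 by rewrite exprMn exprVn n2 sqr_sqrtr.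
have b2 : semi_minor E ^+ 2 = dot r r / 2 by rewrite exprMn exprVn m2 sqr_sqrtr.
have dotd x : dot x (major_dir E) = dot x s / n by coords; ring.
have crossd x : cross x (major_dir E) = cross x s / n by coords; ring.
have dfs : dot f s = dot s s / 2.
  have -> : dot f s = dot f f + dot f g by rewrite /s; coords; ring.
  by rewrite SE -efg; field.
have dgs : dot g s = dot s s / 2.
  have -> : dot g s = dot g g + dot f g by rewrite /s; coords; ring.
  by rewrite SE -efg; field.
have cfs : cross f s = cross f g by rewrite /s; coords; ring.
have cgs : cross g s = - cross f g by rewrite /s; coords; ring.
have DS : dot r r = 4 * cross f g ^+ 2 / n ^+ 2.
  by rewrite -SD n2; field; exact: lt0r_neq0.
have nn := lt0r_neq0 n0.
have area : area2 E = semi_major E ^+ 2 * semi_minor E ^+ 2 by exact: exprMn.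
rewrite /conjugate_radii /form /polar area a2 b2 !dotd !crossd.
by rewrite dfs dgs cfs cgs DS -n2; split; field.
Qed.

(** * Chords and diameters in terms of conjugate radii *)

(** In the coordinates of [f], [g] the curve is the unit circle, and two distinct points at equal
    height on it have opposite abscissas. *)
Lemma chord_radii E f g s : conjugate_radii E f g -> chord E s ->
  parallel s (0, f) ->
  exists X Y : R, [/\ s.1 = center E + (X *: f + Y *: g),
    s.2 = center E + (- X *: f + Y *: g) & X ^+ 2 + Y ^+ 2 = 1].
Proof.
move=> r [s1 s2 s12] par; have fg0 := conjugate_radii_cross_neq0 r.
have [X1 [Y1 [e1 [/(_ s1) c1 _]]]] := curve_radiiP s.1 r.
have [X2 [Y2 [e2 [/(_ s2) c2 _]]]] := curve_radiiP s.2 r.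
have Y12 : Y1 = Y2.
  apply/eqP; rewrite -subr_eq0; apply/eqP/(mulIf fg0); rewrite mul0r -par /=.
  by rewrite e1 e2; coords; ring.
subst Y2; have : (X1 - X2) * (X1 + X2) = 0.
  have -> : (X1 - X2) * (X1 + X2) = X1 ^+ 2 + Y1 ^+ 2 - (X2 ^+ 2 + Y1 ^+ 2) by ring.
  by rewrite c1 c2 subrr.
move=> /eqP; rewrite mulf_eq0 subr_eq0 addr_eq0 => /orP[/eqP X12|/eqP X12].
  by case: s12; rewrite e1 e2 X12.
by exists X1, Y1; rewrite e1 e2 X12 opprK -X12.
Qed.

Lemma segment_mid c f (t : R) : t ^+ 2 <= 1 -> segment (c - f) (c + f) (c + t *: f).
Proof.
move=> t1; exists ((1 + t) / 2); split; last by apply: point_eqP; coords; field.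
by nra.
Qed.

Lemma segmentC p q : segment p q = segment q p.
Proof.
by apply/seteqP; split=> x [t [/andP[t0 t1] ->]]; exists (1 - t); split;
  try (by apply: point_eqP; coords; ring); lra.
Qed.

(** Passing through the center forces height 0, hence abscissas 1 and -1 in either order. This gives
    the uniqueness of the pair of diameters. *)
Lemma diameter_segment E f g s : conjugate_radii E f g -> diameter E s ->
  parallel s (0, f) ->
  segment s.1 s.2 = segment (center E - f) (center E + f).
Proof.
move=> r [ch [t [t01 cE]]] par.
have [X [Y [e1 e2 XY]]] := chord_radii r ch par.
have fg0 := conjugate_radii_cross_neq0 r.
have Y0 : Y = 0.
  apply: (mulIf fg0); rewrite mul0r -[RHS](_ : cross f (center E - center E) = 0).
    by rewrite {1}cE e1 e2; coords; ring.
  by coords; ring.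
subst Y; move: XY => /eqP; rewrite expr0n addr0 sqrf_eq1 => /orP[]/eqP X1.
  rewrite segmentC e1 e2 X1; congr segment; apply: point_eqP; coords; ring.
by rewrite e1 e2 X1; congr segment; apply: point_eqP; coords; ring.
Qed.

Lemma diameter_radii E f g : conjugate_radii E f g ->
  diameter E (center E - f, center E + f).
Proof.
move=> r; have [f0 _] := cross_neq0 (conjugate_radii_cross_neq0 r).
split; last first.
  rewrite -[X in segment _ _ X]addr0 -(scale0r f); apply: segment_mid.
  by rewrite expr0n ler01.
split=> /=.
- have := curve_radii (-1) 0 r; rewrite scaleN1r scale0r addr0 => -[_]; apply.
  by ring.
- have := curve_radii 1 0 r; rewrite scale1r scale0r addr0 => -[_]; apply.
  by ring.
- move/addrI/eqP; rewrite eq_sym -subr_eq0 opprK -mulr2n -scaler_nat scaler_eq0.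
  by rewrite (negPf f0) pnatr_eq0.
Qed.

Lemma conjugate_diameters_radii E f g : conjugate_radii E f g ->
  conjugate_diameters E (center E - f, center E + f) (center E - g, center E + g).
Proof.
move=> r; split.
- exact: diameter_radii r.
- exact: diameter_radii (conjugate_radii_sym r).
move=> s ch par.
have par' : parallel s (0, f).
  apply: (@mulfI _ 2); first by rewrite pnatr_eq0.
  by rewrite mulr0 -[RHS]par; coords; ring.
have [X [Y [-> -> XY]]] := chord_radii r ch par'.
rewrite (_ : midpoint _ _ = center E + Y *: g).
  by apply: segment_mid; rewrite -XY lerDr sqr_ge0.
by apply: point_eqP; coords; field.
Qed.

Lemma equal_radii_diameters E Q f g :
  conjugate_radii E f g -> dot f f = dot g g ->
  cross f (Q 2 - Q 0) = 0 -> cross g (Q 3 - Q 1) = 0 ->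
  Q 2 != Q 0 -> Q 3 != Q 1 ->
  exists l m, conjugate_diameters_along_diagonals E Q l m /\
    (forall l' m', conjugate_diameters_along_diagonals E Q l' m' ->
       segment l'.1 l'.2 = segment l.1 l.2 /\
       segment m'.1 m'.2 = segment m.1 m.2) /\
    equal_conjugate_diameters E l m.
Proof.
move=> r efg cf cg n02 n13; have cd := conjugate_diameters_radii r.
(* Two vectors parallel to a third are parallel to each other only if the third is nonzero; here it
   is a diagonal. *)
have par0 (s : point * point) h w : w != 0 -> cross h w = 0 ->
    cross (s.2 - s.1) w = 0 -> parallel s (0, h).
  move=> w0 hw sw; rewrite /parallel /= subr0.
  apply/eqP; apply: contraTT isT => c0; case/negP: w0; apply/eqP.
  rewrite (cross_decomp w c0) (_ : cross w h = - cross h w); last by coords; ring.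
  by rewrite hw sw oppr0 !mul0r !scale0r addr0.
exists (center E - f, center E + f), (center E - g, center E + g); split; last split.
- split=> //; rewrite /parallel /=.
  + by rewrite -[RHS](mulr0 2) -cf; coords; ring.
  + by rewrite -[RHS](mulr0 2) -cg; coords; ring.
- move=> l' m' [[dl dm _] pl pm]; split.
  + by apply: (diameter_segment r dl (par0 _ _ _ _ cf pl)); rewrite subr_eq0.
  + apply: (diameter_segment (conjugate_radii_sym r) dm (par0 _ _ _ _ cg pm)).
    by rewrite subr_eq0.
- split=> //; rewrite /dist /=; congr Num.sqrt.
  have diam h : dot (center E + h - (center E - h)) (center E + h - (center E - h))
     = 4 * dot h h by coords; ring.
  by rewrite !diam efg.
Qed.


(** * Inscribed ellipses *)

Lemma sum4_rot (V : zmodType) (F : 'I_4 -> V) (i : 'I_4) :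
  \sum_j F j = F i + F (i + 1) + F (i + 2) + F (i + 3).
Proof. by rewrite (reindex_inj (addrI i)) sum4 addr0. Qed.

(** On the side line, the weights of the other two vertices satisfy [w2 * c2 + w3 * c3 = 0]. By
    convexity [c2] and [c3] have the same sign, so both weights vanish. Thus a point of contact
    inside the region lies on the side itself. *)
Lemma quad_region_side Q (i : 'I_4) x : convex_quadrilateral Q ->
  quad_region Q x -> line (Q i) (Q (i + 1)) x -> segment (Q i) (Q (i + 1)) x.
Proof.
move=> /(_ i); set c2 := cross _ (Q (i + 2) - _); set c3 := cross _ (Q (i + 3) - _).
move=> c23 [w [w0 w1 xE]] /lineE [t xt].
rewrite (sum4_rot _ i) in w1; rewrite (sum4_rot _ i) in xE.
have : w (i + 2) * c2 + w (i + 3) * c3 = 0.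
  have wi : w i = 1 - w (i + 1) - w (i + 2) - w (i + 3) by rewrite -w1; ring.
  transitivity (cross (Q (i + 1) - Q i) (x - Q i)); last by rewrite xt; coords; ring.
  by rewrite xE wi /c2 /c3; coords; ring.
have [w2 w3] := (w0 (i + 2), w0 (i + 3)).
have coef0 : forall a b : R, 0 <= a -> 0 <= b -> 0 < c2 * c3 ->
    a * c2 + b * c3 = 0 -> a = 0 /\ b = 0.
  move=> a b a0 b0 c0 e.
  (* Multiplying by [c2] makes both terms nonnegative, whatever the orientation of the
     quadrilateral. *)
  have e2 : a * c2 ^+ 2 + b * (c2 * c3) = 0 by rewrite -[RHS](mulr0 c2) -e; ring.
  have c2n : c2 != 0 by apply: contraTneq c0 => ->; rewrite mul0r ltxx.
  have c2p : 0 < c2 ^+ 2 by rewrite exprn_even_gt0.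
  move/eqP: e2; rewrite paddr_eq0 ?(mulr_ge0 _ (ltW _)) //.
  rewrite (mulf_eq0 a) (mulf_eq0 b) (gt_eqF c2p) (gt_eqF c0) !orbF.
  by move=> /andP[/eqP -> /eqP ->].
move=> /(coef0 _ _ w2 w3 c23) [e2 e3].
rewrite e2 e3 !scale0r !addr0 in xE; rewrite e2 e3 !addr0 in w1.
exists (w (i + 1)); split; last by rewrite xE -w1; congr (_ *: _ + _); ring.
by rewrite w0 -w1 lerDr w0.
Qed.

(* An affine image of a kite; [u] and [v] need not be orthogonal. *)
Definition kite Q P u v (k : R) : Prop :=
  [/\ Q 0 = P - u, Q 1 = P + v, Q 2 = P + u, Q 3 = P - k *: v &
      0 < k /\ cross u v != 0].

(** The two equations express tangency to the lines of the sides at [Q 1] and at [Q 3]. Being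
    quadratic, they do not locate the center between these vertices; the bounds on [y] do. *)
Definition kite_tangency E P u v (k y A B : R) : Prop :=
  [/\ [/\ 0 < A, 0 < B, - k < y & y < 1],
      center E = P + y *: v,
      conjugate_radii E (A *: u) (B *: v),
      A ^+ 2 + B ^+ 2 = (1 - y) ^+ 2 &
      k ^+ 2 * A ^+ 2 + B ^+ 2 = (k + y) ^+ 2].

Lemma side_indices : [/\ (0 + 1 = 1 :> 'I_4), (1 + 1 = 2 :> 'I_4),
  (2 + 1 = 3 :> 'I_4) & (3 + 1 = 0 :> 'I_4)].
Proof. by split; exact: val_inj. Qed.

Lemma kite_sides Q P u v k : kite Q P u v k ->
  [/\ Q 0 != Q (0 + 1), Q 1 != Q (1 + 1), Q 2 != Q (2 + 1) & Q 3 != Q (3 + 1)].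
Proof.
have [-> -> -> ->] := side_indices.
case=> -> -> -> -> [k0 uv].
split; apply: contraNneq uv => e.
- have -> : cross u v = cross (P + v - (P - u)) v by coords; ring.
  by rewrite e; apply/eqP; coords; ring.
- have -> : cross u v = cross (P + u - (P + v)) v by coords; ring.
  by rewrite e; apply/eqP; coords; ring.
- have -> : cross u v = cross (P + u - (P - k *: v)) v by coords; ring.
  by rewrite e; apply/eqP; coords; ring.
- have -> : cross u v = cross (P - k *: v - (P - u)) v by coords; ring.
  by rewrite e; apply/eqP; coords; ring.
Qed.

(** The unknowns are the coordinates [x], [y] of the center and the values [g], [h], [be] of the
    form on [u], [v]. Subtracting the tangency equations of the two sides at [Q 1], and of those at
    [Q 3], isolates [be] twice; comparison gives [x = 0], then [be = 0]. *)
Lemma inscribed_tangency E Q P u v k : kite Q P u v k -> inscribed E Q ->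
  exists y A B : R, kite_tangency E P u v k y A B.
Proof.
move=> kQ [sub tg]; have [n0 n1 n2 n3] := kite_sides kQ.
have tgi i : Q i != Q (i + 1) ->
    form E (Q (i + 1) - Q i) = cross (Q (i + 1) - Q i) (center E - Q i) ^+ 2.
  by move=> n; apply/(tangent_lineP E n); have [T [_ e]] := tg i; exists T.
move: (tgi 0 n0) (tgi 1 n1) (tgi 2 n2) (tgi 3 n3) => {tgi n0 n1 n2 n3 tg}.
have [-> -> -> ->] := side_indices.
case: kQ => Q0 Q1 Q2 Q3 [k0 uv].
rewrite Q0 Q1 Q2 Q3.
have := cross_decomp (center E - P) uv.
move: (_ / _) (_ / _) => y x cE.
have {}cE : center E = P + (x *: u + y *: v) by rewrite -cE addrC subrK.
rewrite cE; set K := cross u v; set g := form E u; set h := form E v.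
set be := polar E u v.
have -> : form E (P + v - (P - u)) = g + 2 * be + h by rewrite /g/h/be; coords; ring.
have -> : form E (P + u - (P + v)) = g - 2 * be + h by rewrite /g/h/be; coords; ring.
have -> : form E (P - k *: v - (P + u)) = g + 2 * k * be + k ^+ 2 * h.
  by rewrite /g/h/be; coords; ring.
have -> : form E (P - u - (P - k *: v)) = g - 2 * k * be + k ^+ 2 * h.
  by rewrite /g/h/be; coords; ring.
have -> : cross (P + v - (P - u)) (P + (x *: u + y *: v) - (P - u)) = K * (y - x - 1).
  by rewrite /K; coords; ring.
have -> : cross (P + u - (P + v)) (P + (x *: u + y *: v) - (P + v)) = K * (y + x - 1).
  by rewrite /K; coords; ring.
have -> : cross (P - k *: v - (P + u)) (P + (x *: u + y *: v) - (P + u)) =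
    K * (k * x - k - y).
  by rewrite /K; coords; ring.
have -> : cross (P - u - (P - k *: v)) (P + (x *: u + y *: v) - (P - k *: v)) =
    - K * (k * x + k + y).
  by rewrite /K; coords; ring.
move=> e0 e1 e2 e3.
have K2 : K ^+ 2 != 0 by rewrite expf_neq0.
have kn := lt0r_neq0 k0.
have bE : be = K ^+ 2 * (x * (1 - y)).
  have -> : be = ((g + 2 * be + h) - (g - 2 * be + h)) / 4 by field.
  by rewrite e0 e1; field.
have bE' : be = - (K ^+ 2 * (x * (k + y))).
  have -> : be = ((g + 2 * k * be + k ^+ 2 * h) - (g - 2 * k * be + k ^+ 2 * h))
    / (4 * k) by field.
  by rewrite e2 e3; field.
have x0 : x = 0.
  have : K ^+ 2 * (x * (1 + k)) = 0.
    rewrite (_ : _ * _ = K ^+ 2 * (x * (1 - y)) - - (K ^+ 2 * (x * (k + y)))).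
      by rewrite -bE -bE' subrr.
    by ring.
  move/eqP; rewrite mulf_eq0 (negPf K2) mulf_eq0 (gt_eqF (addr_gt0 ltr01 k0)) orbF.
  by move/eqP.
have b0 : be = 0 by rewrite bE x0 mul0r mulr0.
have [u0 v0] := cross_neq0 uv.
have g0 : 0 < g := form_gt0 E u0; have h0 : 0 < h := form_gt0 E v0.
have gr : g * h = area2 E * K ^+ 2.
  by rewrite -form_gram -/be b0 expr0n subr0.
have Kp : 0 < K ^+ 2 by rewrite lt0r K2 sqr_ge0.
have [hK gK] : 0 <= h / K ^+ 2 /\ 0 <= g / K ^+ 2 by rewrite !divr_ge0 ?ltW.
(* For [A u] to be a radius, [A^2 g] must be [area2 E], which is [g h / K^2] since [be = 0];
   similarly for [B]. *)
set A := Num.sqrt (h / K ^+ 2); set B := Num.sqrt (g / K ^+ 2).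
have A2 : A ^+ 2 = h / K ^+ 2 by rewrite sqr_sqrtr.
have B2 : B ^+ 2 = g / K ^+ 2 by rewrite sqr_sqrtr.
have AB1 : A ^+ 2 + B ^+ 2 = (1 - y) ^+ 2.
  apply: (mulIf K2); rewrite A2 B2 mulrDl !divfK //.
  transitivity (g + 2 * be + h); first by rewrite b0; ring.
  by rewrite e0 x0; ring.
have AB2 : k ^+ 2 * A ^+ 2 + B ^+ 2 = (k + y) ^+ 2.
  apply: (mulIf K2); rewrite A2 B2 mulrDl -mulrA !divfK //.
  transitivity (g + 2 * k * be + k ^+ 2 * h); first by rewrite b0; ring.
  by rewrite e2 x0; ring.
have {}cE : center E = P + y *: v by rewrite cE x0 scale0r add0r.
have rE : conjugate_radii E (A *: u) (B *: v).
  have area : area2 E = g * h / K ^+ 2 by rewrite gr mulfK.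
  split.
  - have -> : form E (A *: u) = A ^+ 2 * g by rewrite /g; coords; ring.
    by rewrite A2 area; field; rewrite -sqrf_eq0.
  - have -> : form E (B *: v) = B ^+ 2 * h by rewrite /h; coords; ring.
    by rewrite B2 area; field; rewrite -sqrf_eq0.
  - have -> : polar E (A *: u) (B *: v) = A * B * be by rewrite /be; coords; ring.
    by rewrite b0 mulr0.
have A0 : 0 < A by rewrite sqrtr_gt0 divr_gt0.
have B0 : 0 < B by rewrite sqrtr_gt0 divr_gt0.
(* The bounds on [y] hold weakly because a point of the curve has the same
   [v]-coordinate as the center; they are strict since [A] and [B] are not 0. *)
have [y_ge y_le] : - k <= y /\ y <= 1.
  have [|w [w0 w1 wE]] := sub (center E + (1 *: (A *: u) + 0 *: (B *: v))).
    by apply/(curve_radii _ _ rE); ring.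
  rewrite sum4 in w1; rewrite sum4 Q0 Q1 Q2 Q3 cE in wE.
  have yE : y = w 1 - k * w 3.
    apply: (mulfI uv).
    have w0E : w 0 = 1 - w 1 - w 2 - w 3 by rewrite -w1; ring.
    transitivity (cross u (P + y *: v + (1 *: (A *: u) + 0 *: (B *: v)) - P)).
      by coords; ring.
    by rewrite wE w0E; coords; ring.
  by have := w0 0; have := w0 1; have := w0 2; have := w0 3; nra.
have AA := exprn_gt0 2 A0; have BB := exprn_gt0 2 B0.
have kA := mulr_gt0 (exprn_gt0 2 k0) AA.
exists y, A, B; split=> //; split=> //; rewrite lt_neqAle ?y_ge ?y_le andbT.
- by apply/eqP => e; move: AB2; rewrite -e subrr expr0n /=; lra.
- by apply/eqP => e; move: AB1; rewrite e subrr expr0n /=; lra.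
Qed.

Lemma le_of_sqr (a b : R) : 0 <= b -> a ^+ 2 <= b ^+ 2 -> a <= b.
Proof.
move=> b0 ab; rewrite leNgt; apply/negP => ba.
by nra.
Qed.

Lemma eq_of_sqr (a b : R) : 0 <= a -> 0 <= b -> a ^+ 2 = b ^+ 2 -> a = b.
Proof.
by move=> a0 b0 ab; apply/le_anti/andP; split; apply: le_of_sqr; rewrite // ab.
Qed.

(** The four inequalities are the half-planes of the sides. The diagonal along [u] cuts the kite
    into two triangles, and barycentric coordinates in the appropriate one serve as weights. *)
Lemma kite_region Q P u v k (X Y : R) : kite Q P u v k ->
  X + Y <= 1 -> - X + Y <= 1 -> k * X - Y <= k -> - (k * X) - Y <= k ->
  quad_region Q (P + (X *: u + Y *: v)).
Proof.
move=> [Q0 Q1 Q2 Q3 [k0 _]] h1 h2 h3 h4; have kn := lt0r_neq0 k0.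
have [Y0|/ltW Y0] := lerP 0 Y.
  exists (fun i => if i == 0 then (1 - Y - X) / 2 else if i == 1 then Y
                   else if i == 2 then (1 - Y + X) / 2 else 0).
  split.
  - by apply: ord4_ind => /=; lra.
  - by rewrite sum4 /=; field.
  - by rewrite sum4 /= Q0 Q1 Q2 Q3; apply: point_eqP; coords; field.
(* Below the diagonal, [Q 3] carries the weight [- Y / k] and [Q 1] none. *)
exists (fun i => if i == 0 then (1 + Y / k - X) / 2 else if i == 1 then 0
                 else if i == 2 then (1 + Y / k + X) / 2 else - Y / k).
split.
- have a1 : 0 <= (k + Y - k * X) / k by rewrite divr_ge0 ?(ltW k0) //; lra.
  have a2 : 0 <= (k + Y + k * X) / k by rewrite divr_ge0 ?(ltW k0) //; lra.
  have e1 : (k + Y - k * X) / k = 1 + Y / k - X by field.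
  have e2 : (k + Y + k * X) / k = 1 + Y / k + X by field.
  rewrite e1 in a1; rewrite e2 in a2.
  by apply: ord4_ind => /=; rewrite ?divr_ge0 ?oppr_ge0 // ltW.
- by rewrite sum4 /=; field.
- by rewrite sum4 /= Q0 Q1 Q2 Q3; apply: point_eqP; coords; field.
Qed.

Lemma tangency_inscribed E Q P u v (k y A B : R) : convex_quadrilateral Q ->
  kite Q P u v k -> kite_tangency E P u v k y A B -> inscribed E Q.
Proof.
move=> cQ kQ [[A0 B0 ky y1] cE rE AB1 AB2].
have sub : curve E `<=` quad_region Q.
  move=> x; have [X [Y [-> ->]]] := curve_radiiP x rE; rewrite cE => XY.
  have -> : P + y *: v + (X *: (A *: u) + Y *: (B *: v)) =
     P + ((X * A) *: u + (y + Y * B) *: v) by apply: point_eqP; coords; ring.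
  (* Cauchy-Schwarz bounds each linear form on the curve; by the tangency equations the bound is
     exactly the distance [1 - y] or [k + y] allowed by the corresponding side. *)
  have CS (a b : R) : (X * a + Y * b) ^+ 2 <= a ^+ 2 + b ^+ 2.
    rewrite -subr_ge0 -[X in X - _]mul1r -XY.
    by rewrite (_ : _ - _ = (X * b - Y * a) ^+ 2) ?sqr_ge0 //; ring.
  have y1' : 0 <= 1 - y by rewrite subr_ge0 ltW.
  have ky' : 0 <= k + y by rewrite -lerBlDl sub0r ltW.
  have := CS A B; have := CS (- A) B; have := CS (k * A) (- B).
  have := CS (- (k * A)) (- B); rewrite !sqrrN !exprMn AB1 AB2.
  move=> /(le_of_sqr ky') c4 /(le_of_sqr ky') c3 /(le_of_sqr y1') c2 /(le_of_sqr y1') c1.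
  by apply: (kite_region kQ); lra.
split=> // i.
suff [T Te] : exists T, curve E `&` line (Q i) (Q (i + 1)) = [set T].
  exists T; split=> //.
  have [cT lT] : (curve E `&` line (Q i) (Q (i + 1))) T by rewrite Te.
  by apply: quad_region_side => //; exact: sub.
have [n0 n1 n2 n3] := kite_sides kQ; have uv := conjugate_radii_cross rE.
have area : area2 E = A ^+ 2 * B ^+ 2 * cross u v ^+ 2 by rewrite -uv; coords; ring.
have formE (s t : R) : form E (s *: u + t *: v) =
    cross u v ^+ 2 * (s ^+ 2 * B ^+ 2 + t ^+ 2 * A ^+ 2).
  have -> : s *: u + t *: v = (s / A) *: (A *: u) + (t / B) *: (B *: v).
    by rewrite !scalerA !divfK ?lt0r_neq0.
  rewrite (conjugate_radii_form _ _ rE) area; field.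
  by rewrite !lt0r_neq0.
case: kQ => Q0 Q1 Q2 Q3 _.
move: i; apply: ord4_ind; apply/tangent_lineP => //.
all: have [i01 i12 i23 i30] := side_indices;
  rewrite ?i01 ?i12 ?i23 ?i30 ?Q0 ?Q1 ?Q2 ?Q3 cE.
- transitivity (form E (1 *: u + 1 *: v)).
    by congr form; apply: point_eqP; coords; ring.
  rewrite formE [cross (_ - _) _](_ : _ = cross u v * (y - 1)); last by coords; ring.
  by rewrite exprMn -[(y - 1) ^+ 2]sqrrN opprB -AB1; ring.
- transitivity (form E (1 *: u + (-1) *: v)).
    by congr form; apply: point_eqP; coords; ring.
  rewrite formE [cross (_ - _) _](_ : _ = cross u v * (y - 1)); last by coords; ring.
  by rewrite exprMn -[(y - 1) ^+ 2]sqrrN opprB -AB1; ring.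
- transitivity (form E ((-1) *: u + (-k) *: v)).
    by congr form; apply: point_eqP; coords; ring.
  rewrite formE [cross (_ - _) _](_ : _ = cross u v * - (k + y)); last by coords; ring.
  by rewrite exprMn !sqrrN -AB2; ring.
- transitivity (form E ((-1) *: u + k *: v)).
    by congr form; apply: point_eqP; coords; ring.
  rewrite formE [cross (_ - _) _](_ : _ = cross u v * - (k + y)); last by coords; ring.
  by rewrite exprMn !sqrrN -AB2; ring.
Qed.


(** * Minimal eccentricity *)

Definition equal_lengths u v (A B : R) : Prop :=
  A ^+ 2 * dot u u = B ^+ 2 * dot v v.

Lemma equal_lengthsP u v A B :
  equal_lengths u v A B <-> dot (A *: u) (A *: u) = dot (B *: v) (B *: v).
Proof.
rewrite /equal_lengths.
have -> : dot (A *: u) (A *: u) = A ^+ 2 * dot u u by coords; ring.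
by have -> : dot (B *: v) (B *: v) = B ^+ 2 * dot v v by coords; ring.
Qed.

Lemma equal_lengths_scale u v (A B : R) : cross u v != 0 -> 0 < A -> 0 < B ->
  equal_lengths u v A B -> exists m, [/\ 0 < m,
    A = m * Num.sqrt (dot v v) & B = m * Num.sqrt (dot u u)].
Proof.
move=> /cross_neq0[/dot_gt0 U0 /dot_gt0 V0] A0 B0 AB.
have rV0 : 0 < Num.sqrt (dot v v) by rewrite sqrtr_gt0.
have rU0 : 0 < Num.sqrt (dot u u) by rewrite sqrtr_gt0.
exists (A / Num.sqrt (dot v v)); split; first exact: divr_gt0.
  by rewrite divfK // lt0r_neq0.
apply: eq_of_sqr; first exact: ltW.
  by rewrite mulr_ge0 ?divr_ge0 // ltW.
rewrite !exprMn exprVn !sqr_sqrtr ?(ltW U0) ?(ltW V0) //.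
by rewrite mulrAC AB mulfK // lt0r_neq0.
Qed.

(* With [A = m |v|] and [B = m |u|], the two tangency equations become linear
   in [m] and [y]. *)
Lemma equal_tangency_linear u v (k y m : R) :
  0 < m -> - k < y -> y < 1 ->
  (m * Num.sqrt (dot v v)) ^+ 2 + (m * Num.sqrt (dot u u)) ^+ 2 = (1 - y) ^+ 2 ->
  k ^+ 2 * (m * Num.sqrt (dot v v)) ^+ 2 + (m * Num.sqrt (dot u u)) ^+ 2 =
    (k + y) ^+ 2 ->
  1 - y = m * Num.sqrt (dot v v + dot u u) /\
  k + y = m * Num.sqrt (k ^+ 2 * dot v v + dot u u).
Proof.
move=> m0 ky y1; have dge0 w : 0 <= dot w w.
  by rewrite dot_coord addr_ge0 // -expr2 sqr_ge0.
rewrite !exprMn !sqr_sqrtr // => e1 e2.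
have kV : 0 <= k ^+ 2 * dot v v by rewrite mulr_ge0 ?sqr_ge0.
split; apply: eq_of_sqr.
- by lra.
- by rewrite mulr_ge0 ?sqrtr_ge0 // ltW.
- by rewrite exprMn sqr_sqrtr ?addr_ge0 // -e1; ring.
- by lra.
- by rewrite mulr_ge0 ?sqrtr_ge0 // ltW.
- by rewrite exprMn sqr_sqrtr ?addr_ge0 // -e2; ring.
Qed.

(** Adding the two linear equations eliminates [y] and gives [1 + k = m (s + t)], which determines
    [m], then [y], and so the center and the radii. *)
Lemma equal_tangency_unique E E' P u v (k y A B y' A' B' : R) :
  cross u v != 0 -> 0 < k ->
  kite_tangency E P u v k y A B -> equal_lengths u v A B ->
  kite_tangency E' P u v k y' A' B' -> equal_lengths u v A' B' ->
  curve E' = curve E.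
Proof.
move=> uv k0 [[A0 B0 ky y1] cE rE e1 e2] AB [[A0' B0' ky' y1'] cE' rE' e1' e2'] AB'.
have [m [m0 Am Bm]] := equal_lengths_scale uv A0 B0 AB.
have [m' [m0' Am' Bm']] := equal_lengths_scale uv A0' B0' AB'.
subst A B A' B'.
have [l1 l2] := equal_tangency_linear m0 ky y1 e1 e2.
have [l1' l2'] := equal_tangency_linear m0' ky' y1' e1' e2'.
set s := Num.sqrt _ in l1 l1'; set t := Num.sqrt _ in l2 l2'.
have st : s + t != 0.
  by apply: contraTneq k0 => e; rewrite -leNgt; nra.
have mm : m = m'.
  by apply: (mulIf st); rewrite !mulrDr -l1 -l2 -l1' -l2'; ring.
subst m'; have yy : y = y' by move: l1 l1'; lra.
by subst y'; apply: (@eq_curve E' E _ _ _ rE' rE); rewrite cE cE'.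
Qed.

Lemma equal_tangency_exists P u v (k : R) : cross u v != 0 -> 0 < k ->
  exists E (y A B : R), kite_tangency E P u v k y A B /\ equal_lengths u v A B.
Proof.
move=> uv k0; have [/dot_gt0 U0 /dot_gt0 V0] := cross_neq0 uv.
set U := dot u u; set V := dot v v.
have rV0 : 0 < Num.sqrt V by rewrite sqrtr_gt0.
have rU0 : 0 < Num.sqrt U by rewrite sqrtr_gt0.
have VU : 0 < V + U by rewrite addr_gt0.
have kVU : 0 < k ^+ 2 * V + U by rewrite addr_gt0 // mulr_gt0 ?exprn_gt0.
set s := Num.sqrt (V + U); set t := Num.sqrt (k ^+ 2 * V + U).
have s2 : s ^+ 2 = V + U by rewrite sqr_sqrtr // ltW.
have t2 : t ^+ 2 = k ^+ 2 * V + U by rewrite sqr_sqrtr // ltW.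
have s0 : 0 < s by rewrite sqrtr_gt0.
have t0 : 0 < t by rewrite sqrtr_gt0.
have st : s + t != 0 by rewrite lt0r_neq0 ?addr_gt0.
set m := (1 + k) / (s + t).
have m0 : 0 < m by rewrite divr_gt0 ?addr_gt0.
have y1 : 1 - (1 - m * s) = m * s by ring.
have y2 : k + (1 - m * s) = m * t by rewrite /m; field.
set A := m * Num.sqrt V; set B := m * Num.sqrt U.
have A0 : 0 < A by rewrite mulr_gt0.
have B0 : 0 < B by rewrite mulr_gt0.
have A2 : A ^+ 2 = m ^+ 2 * V by rewrite exprMn sqr_sqrtr // ltW.
have B2 : B ^+ 2 = m ^+ 2 * U by rewrite exprMn sqr_sqrtr // ltW.
have AB : equal_lengths u v A B by rewrite /equal_lengths A2 B2 -/U -/V; ring.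
have cAB : cross (A *: u) (B *: v) != 0.
  have -> : cross (A *: u) (B *: v) = A * B * cross u v by coords; ring.
  apply: mulf_neq0 => //; apply: mulf_neq0; exact: lt0r_neq0.
have [E [cE rE]] := @ellipse_of_equal_radii (P + (1 - m * s) *: v) _ _
  ((equal_lengthsP u v A B).1 AB) cAB.
exists E, (1 - m * s), A, B; split=> //; split=> //.
- have ms := mulr_gt0 m0 s0; have mt := mulr_gt0 m0 t0.
  by split=> //; lra.
- by rewrite y1 A2 B2; transitivity (m ^+ 2 * s ^+ 2); [rewrite s2|]; ring.
- by rewrite y2 A2 B2; transitivity (m ^+ 2 * t ^+ 2); [rewrite t2|]; ring.
Qed.

(** Write [p'], [q'] for the squared lengths of the radii of [E']. After a common positive factor is
    removed, the comparison is [(p' + q')^2 - 4 p' q' = (p' - q')^2 >= 0], with equality exactly for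
    equal lengths. *)
Lemma equal_tangency_min E E' P u v (k y A B y' A' B' : R) : cross u v != 0 ->
  kite_tangency E P u v k y A B -> equal_lengths u v A B ->
  kite_tangency E' P u v k y' A' B' ->
  eccentricity E <= eccentricity E' /\
  (eccentricity E' <= eccentricity E -> equal_lengths u v A' B').
Proof.
move=> uv [[A0 B0 _ _] _ rE _ _] AB [[A0' B0' _ _] _ rE' _ _].
have [/dot_gt0 U0 /dot_gt0 V0] := cross_neq0 uv.
have dotZ (a : R) w : dot (a *: w) (a *: w) = a ^+ 2 * dot w w by coords; ring.
have crossZ (a b : R) : cross (a *: u) (b *: v) = a * b * cross u v by coords; ring.
rewrite (eccentricity_le_radii rE rE') (eccentricity_le_radii rE' rE).
rewrite !dotZ !crossZ; move: AB; rewrite /equal_lengths => AB; rewrite -AB.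
set p := A ^+ 2 * dot u u in AB *.
set p' := A' ^+ 2 * dot u u; set q' := B' ^+ 2 * dot v v.
have p0 : 0 < p by rewrite mulr_gt0 ?exprn_gt0.
have W0 : 0 < dot u u * dot v v by rewrite mulr_gt0.
have K0 : 0 < cross u v ^+ 2 by rewrite lt0r sqrf_eq0 uv sqr_ge0.
have W : (A * B * cross u v) ^+ 2 = p ^+ 2 * cross u v ^+ 2 / (dot u u * dot v v).
  by rewrite [p ^+ 2]expr2 {2}AB /p; field; rewrite !lt0r_neq0.
have W' : (A' * B' * cross u v) ^+ 2 = p' * q' * cross u v ^+ 2 / (dot u u * dot v v).
  by rewrite /p' /q'; field; rewrite !lt0r_neq0.
have c0 : 0 < p ^+ 2 * cross u v ^+ 2 / (dot u u * dot v v).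
  by rewrite divr_gt0 // mulr_gt0 // exprn_gt0.
have diff : (p' + q') ^+ 2 * (A * B * cross u v) ^+ 2 -
  (p + p) ^+ 2 * (A' * B' * cross u v) ^+ 2 =
  p ^+ 2 * cross u v ^+ 2 / (dot u u * dot v v) * (p' - q') ^+ 2.
  by rewrite W W'; field; rewrite !lt0r_neq0.
split; first by rewrite -subr_ge0 diff mulr_ge0 ?sqr_ge0 // ltW.
rewrite -subr_le0 diff pmulr_rle0 // => le0; apply/eqP.
by rewrite -subr_eq0 -sqrf_eq0 eq_le le0 sqr_ge0.
Qed.

(** Any minimizer is compared with the ellipse having equal radii along [u] and [v]: the equality
    case forces equal radii on it too. This yields both its uniqueness and the property of its
    diameters. *)
Lemma kite_minimal Q P u v (k : R) : convex_quadrilateral Q -> kite Q P u v k ->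
  (exists E, minimal_eccentricity_inscribed E Q /\
     forall E', minimal_eccentricity_inscribed E' Q -> curve E' = curve E) /\
  (forall E, minimal_eccentricity_inscribed E Q ->
     exists f g, [/\ conjugate_radii E f g, dot f f = dot g g,
       cross f (Q 2 - Q 0) = 0 & cross g (Q 3 - Q 1) = 0]).
Proof.
move=> cQ kQ; have [Q0 Q1 Q2 Q3 [k0 uv]] := kQ.
have [E [y [A [B [tE AB]]]]] := equal_tangency_exists P uv k0.
have iE := tangency_inscribed cQ kQ tE.
have mE E' : minimal_eccentricity_inscribed E' Q -> exists y' A' B' : R,
    kite_tangency E' P u v k y' A' B' /\ equal_lengths u v A' B'.
  move=> [iE' /(_ E iE) le]; have [y' [A' [B' tE']]] := inscribed_tangency kQ iE'.
  exists y', A', B'; split=> //.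
  by have [_] := equal_tangency_min uv tE AB tE'; apply.
split.
  exists E; split.
    split=> // E' iE'; have [y' [A' [B' tE']]] := inscribed_tangency kQ iE'.
    by have [] := equal_tangency_min uv tE AB tE'.
  move=> E' /mE[y' [A' [B' [tE' AB']]]].
  exact: equal_tangency_unique uv k0 tE AB tE' AB'.
move=> E' /mE[y' [A' [B' [[_ _ rE' _ _] /equal_lengthsP AB']]]].
exists (A' *: u), (B' *: v); split=> //.
- by rewrite Q0 Q2; coords; ring.
- by rewrite Q1 Q3; coords; ring.
Qed.

(** * Reduction of midpoint diagonal quadrilaterals to kites *)

Lemma kite_of_midpoint Q P : convex_quadrilateral Q ->
  segment (Q 1) (Q 3) P -> P = midpoint (Q 0) (Q 2) ->
  exists u v k, kite Q P u v k.
Proof.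
move=> cQ [t [/andP[t0 t1] Pt]] Pm.
have := cQ 0; have := cQ 2.
have -> : 0 + 1 = 1 :> 'I_4 by exact: val_inj.
have -> : 0 + 2 = 2 :> 'I_4 by exact: val_inj.
have -> : 0 + 3 = 3 :> 'I_4 by exact: val_inj.
have -> : 2 + 1 = 3 :> 'I_4 by exact: val_inj.
have -> : 2 + 2 = 0 :> 'I_4 by exact: val_inj.
have -> : 2 + 3 = 1 :> 'I_4 by exact: val_inj.
move=> /lt0r_neq0; rewrite mulf_eq0 => /norP[n3 _].
move=> /lt0r_neq0; rewrite mulf_eq0 => /norP[n1 _].
(* If [t] were 0 or 1, then [Q 1] or [Q 3] would lie on the line through [Q 0] and [Q 2], against
   convexity. *)
have tn0 : t != 0.
  apply: contraNneq n1 => te; rewrite te in Pt.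
  have Q1m : Q 1 = midpoint (Q 0) (Q 2) by rewrite -Pm Pt; apply: point_eqP; coords; ring.
  by rewrite Q1m; apply/eqP; coords; field.
have tn1 : t != 1.
  apply: contraNneq n3 => te; rewrite te in Pt.
  have Q3m : Q 3 = midpoint (Q 0) (Q 2) by rewrite -Pm Pt; apply: point_eqP; coords; ring.
  by rewrite Q3m; apply/eqP; coords; field.
have tp : 0 < t by rewrite lt0r tn0.
have tq : 0 < 1 - t by rewrite subr_gt0 lt_neqAle tn1.
(* The point [P] divides the segment from [Q 1] to [Q 3] in the ratio [t : 1 - t], whence
   [k = (1 - t) / t]. *)
exists (2^-1 *: (Q 2 - Q 0)), (Q 1 - P), ((1 - t) / t); split.
- by rewrite Pm; apply: point_eqP; coords; field.
- by rewrite addrC subrK.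
- by rewrite Pm; apply: point_eqP; coords; field.
- by rewrite Pt; apply: point_eqP; coords; field.
- split; first exact: divr_gt0.
  apply: contraNneq n1 => e.
  have -> : cross (Q 1 - Q 0) (Q 2 - Q 0) =
      - 2 * cross (2^-1 *: (Q 2 - Q 0)) (Q 1 - P) by rewrite Pm; coords; field.
  by rewrite e mulr0.
Qed.

(** Cyclic relabelling of the vertices; it transfers the result to the case where the other diagonal
    is the bisected one. *)
Lemma inscribed_rot E Q (j : 'I_4) :
  inscribed E (fun i => Q (j + i)) <-> inscribed E Q.
Proof.
have reg : quad_region (fun i => Q (j + i)) = quad_region Q.
  apply/seteqP; split=> x [w [w0 w1 ->]].
    exists (fun i => w (i - j)); split=> //.
      by rewrite (reindex_inj (addrI j)) -w1; apply: eq_bigr => i _; rewrite addrC addKr.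
    rewrite [RHS](reindex_inj (addrI j)); apply: eq_bigr => i _.
    by rewrite (addrC j i) addrK.
  exists (fun i => w (j + i)); split=> //.
    by rewrite -w1 [RHS](reindex_inj (addrI j)).
  by rewrite (reindex_inj (addrI j)).
rewrite /inscribed reg; split=> -[sub tg]; split=> // i; last by rewrite addrA.
have ji : j + (i - j) = i by rewrite addrC subrK.
by have := tg (i - j); rewrite [j + (i - j + 1)]addrA ji.
Qed.

Lemma minimal_rot E Q (j : 'I_4) :
  minimal_eccentricity_inscribed E (fun i => Q (j + i)) <->
  minimal_eccentricity_inscribed E Q.
Proof.
split=> -[iE mE]; split=> [|E' iE'].
- exact: (inscribed_rot E Q j).1.
- exact/mE/(inscribed_rot E' Q j).2.
- exact: (inscribed_rot E Q j).2.
- exact/mE/(inscribed_rot E' Q j).1.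
Qed.

Lemma convex_diagonal_neq Q (i : 'I_4) : convex_quadrilateral Q -> Q (i + 2) != Q i.
Proof.
move=> /(_ i)/lt0r_neq0; rewrite mulf_eq0 => /norP[n _].
by apply: contraNneq n => ->; apply/eqP; coords; ring.
Qed.

End Proof.

Theorem theorem5 (R : realType) (Q : quadrilateral R)
    (hQ : midpoint_diagonal_quadrilateral Q) :
  (exists E : ellipse R,
     minimal_eccentricity_inscribed E Q /\
     forall E' : ellipse R,
       minimal_eccentricity_inscribed E' Q -> curve E' = curve E) /\
  (forall E : ellipse R,
     minimal_eccentricity_inscribed E Q ->
     exists l m : 'rV[R]_2 * 'rV[R]_2,
       conjugate_diameters_along_diagonals E Q l m /\
       (forall l' m' : 'rV[R]_2 * 'rV[R]_2,
          conjugate_diameters_along_diagonals E Q l' m' ->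
          segment l'.1 l'.2 = segment l.1 l.2 /\
          segment m'.1 m'.2 = segment m.1 m.2) /\
       equal_conjugate_diameters E l m).
Proof.
case: hQ => cQ [P [PE Pm]].
have [P02 P13] : (segment (Q 0) (Q 2) `&` segment (Q 1) (Q 3)) P by rewrite PE.
have n02 : Q 2 != Q 0 by have := convex_diagonal_neq 0 cQ; rewrite add0r.
have n13 : Q 3 != Q 1.
  by have := convex_diagonal_neq 1 cQ; rewrite (_ : 1 + 2 = 3) //; exact: val_inj.
case: Pm => [Pm|Pm].
  have [u [v [k kQ]]] := kite_of_midpoint cQ P13 Pm.
  have [exE mE] := kite_minimal cQ kQ; split=> // E /mE[f [g [r fg cf cg]]].
  exact: equal_radii_diameters r fg cf cg n02 n13.
(* Shifting the indices by one makes the bisected diagonal join the vertices 0 and 2. *)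
pose Q' (i : 'I_4) := Q (1 + i).
have e0 : Q' 0 = Q 1 by rewrite /Q' addr0.
have e1 : Q' 1 = Q 2 by rewrite /Q'; congr Q; exact: val_inj.
have e2 : Q' 2 = Q 3 by rewrite /Q'; congr Q; exact: val_inj.
have e3 : Q' 3 = Q 0 by rewrite /Q'; congr Q; exact: val_inj.
have cQ' : convex_quadrilateral Q' by move=> i; have := cQ (1 + i); rewrite -!addrA.
have [u [v [k kQ']]] : exists u v k, kite Q' P u v k.
  apply: kite_of_midpoint; rewrite ?e0 ?e1 ?e2 ?e3 //.
  by rewrite segmentC.
have [[E [mE uE]] mE'] := kite_minimal cQ' kQ'; split.
  by exists E; split=> [|E' /(minimal_rot E' Q 1).2]; [exact: (minimal_rot E Q 1).1|exact: uE].
move=> E1 /(minimal_rot E1 Q 1).2/mE'[f [g [r fg cf cg]]].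
rewrite e0 e2 in cf; rewrite e1 e3 in cg.
(* The shift exchanges the diagonals, so [f] and [g] swap roles; it also reverses the direction of
   the diagonal [Q 0], [Q 2], hence the sign below. *)
apply: equal_radii_diameters (conjugate_radii_sym r) (esym fg) _ cf n02 n13.
by rewrite -[RHS]oppr0 -cg /cross !mxE; ring.
Qed.
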